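(* Let $\theta>0$ and $n\ge 2$. The system of the vectors $\bar e_r=(e_{r1},\dots,e_{rn})$, $1\le r\le n$, where $$e_{rj}=\pi_{r-1}^{-1}\,q_{r-1}(j)\sqrt{j\,\Theta(n-j)},\qquad 1\le j\le n,$$ is an orthonormal basis in $\mathbf{R}^n$. Moreover, for each $1\le r\le n$, the vector $\bar e_r$ is an eigenvector of the matrix $M_n$ corresponding to the eigenvalue $$\mu_r=\frac{(-1)^r(r-1)!}{(\theta)_r}.$$
   Context: For $m\in\{0,1,2,\dots\}$, $(x)_m=x(x+1)\cdots(x+m-1)$ (with $(x)_0=1$). $\Theta(m)=(\theta)_m/m!$ for integers $m\ge 0$, and $\Theta(-k)=0$ for integers $k\ge 1$. The matrix $M_n=((m_{ij}))_{1\le i,j\le n}$ is real symmetric with entries $$m_{ij}=\frac{\Theta(n-i-j)}{\big(ij\,\Theta(n-i)\Theta(n-j)\big)^{1/2}}-\Big(\frac{\Theta(n-i)}{i\,\Theta(n)}\Big)^{1/2}\Big(\frac{\Theta(n-j)}{j\,\Theta(n)}\Big)^{1/2}.$$ For $0\le r\le n-1$, $q_r$ is the (discrete Hahn) polynomial $$q_r(x)={}_3F_2\big(-r,\,-x+1,\,r+\theta+1;\,2,\,-n+1;\,1\big)=\sum_{k=0}^{r}\frac{(-r)_k(1-x)_k(r+\theta+1)_k}{(2)_k(1-n)_k\,k!},$$ and $\pi_r>0$ is defined by $$\pi_r^2=\sum_{j=1}^n j\,q_r(j)^2\,\Theta(n-j).$$ Vectors are row vectors and ''eigenvector for $\mu_r$''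 means $\bar e_rM_n=\mu_r\bar e_r$ with $\bar e_r\neq 0$. *)

(* Defs.v *)
From HB Require Import structures.
From mathcomp Require Import all_boot all_order all_algebra.
From mathcomp Require Import reals.
Set Implicit Arguments.
Unset Strict Implicit.
Unset Printing Implicit Defensive.
Import Order.TTheory GRing.Theory Num.Theory.
Local Open Scope ring_scope.

(* x (x + 1) ... (x + m - 1) *)
Definition poch {R : realType} (x : R) (m : nat) : R :=
  \prod_(k < m) (x + k%:R).

Definition Theta {R : realType} (theta : R) (z : int) : R :=
  match z with
  | Posz m => poch theta m / (m`!)%:R
  | Negz _ => 0
  end.

(* The indices i, j of [M_entry], [q_poly], [e_entry] are the 1-based ones;
   an ordinal i : 'I_n of a matrix or vector corresponds to the index i.+1. *)
Definition M_entry {R : realType} (theta : R) (n i j : nat) : R :=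
  Theta theta (n%:Z - i%:Z - j%:Z)
    / Num.sqrt (i%:R * j%:R * Theta theta (n%:Z - i%:Z)
                            * Theta theta (n%:Z - j%:Z))
  - Num.sqrt (Theta theta (n%:Z - i%:Z) / (i%:R * Theta theta n%:Z))
    * Num.sqrt (Theta theta (n%:Z - j%:Z) / (j%:R * Theta theta n%:Z)).

Definition M_mx {R : realType} (theta : R) (n : nat) : 'M[R]_n :=
  \matrix_(i < n, j < n) M_entry theta n i.+1 j.+1.

(* 3F2(-r, 1 - x, r + theta + 1; 2, 1 - n; 1) for r <= n - 1. The series is
   stopped at k = r: its later terms have the factor (-r)_k = 0, and stopping
   there avoids the indices k >= n at which (1 - n)_k vanishes. *)
Definition q_poly {R : realType} (theta : R) (n r : nat) (x : R) : R :=
  \sum_(k < r.+1)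
    (poch (- r%:R) k * poch (1 - x) k * poch (r%:R + theta + 1) k)
      / (poch 2 k * poch (1 - n%:R) k * (k`!)%:R).

Definition pi_norm {R : realType} (theta : R) (n r : nat) : R :=
  Num.sqrt (\sum_(1 <= j < n.+1)
    j%:R * q_poly theta n r j%:R ^+ 2 * Theta theta (n%:Z - j%:Z)).

(* Here r and j range over 1, ..., n. *)
Definition e_entry {R : realType} (theta : R) (n r j : nat) : R :=
  (pi_norm theta n r.-1)^-1 * q_poly theta n r.-1 j%:R
    * Num.sqrt (j%:R * Theta theta (n%:Z - j%:Z)).

Definition e_vec {R : realType} (theta : R) (n r : nat) : 'rV[R]_n :=
  \row_(j < n) e_entry theta n r j.+1.

Definition mu {R : realType} (theta : R) (r : nat) : R :=
  (-1) ^+ r * (r.-1`!)%:R / poch theta r.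

Definition dot {R : realType} (n : nat) (u v : 'rV[R]_n) : R :=
  \sum_(j < n) u 0 j * v 0 j.

Definition orthonormal_basis {R : realType} (n : nat)
    (X : n.-tuple 'rV[R]_n) : Prop :=
  basis_of fullv X
  /\ forall r s : 'I_n, dot (tnth X r) (tnth X s) = (r == s)%:R.

Definition is_eigenvector {R : realType} (n : nat)
    (A : 'M[R]_n) (a : R) (v : 'rV[R]_n) : Prop :=
  v != 0 /\ v *m A = a *: v.

(* Main.v *)
(* Conjugating [M_n] by the square roots of the weights w(j) = j Theta(n - j) turns
   it into an operator T on functions on {1, ..., n} that is self-adjoint for the
   inner product with weight w. Vandermonde's convolution shows that the function
   (i)_k = i (i + 1) ... (i + k - 1) is sent to (F(n - j) - F(n)) / j with
   F(m) = k! m (theta + m)_k / (theta)_(k+1), a polynomial in j of degree k with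
   leading coefficient mu_(k+1). So T does not raise degrees, and it must act by
   the scalar mu_(r+1) on a polynomial of degree r orthogonal to all polynomials of
   smaller degree. That q_r is such a polynomial follows by pairing it with the
   polynomials (theta + n - j)_l, l < r: Vandermonde's convolution reduces the sum
   to an r-th finite difference of a polynomial of degree r - l - 1. *)
Require Import Defs.
From mathcomp Require Import all_boot all_order all_algebra.
From mathcomp Require Import reals.
From mathcomp Require Import ring zify.
Import Order.TTheory GRing.Theory Num.Theory.
Local Open Scope ring_scope.

(** * Pochhammer symbols, Vandermonde's convolution and finite differences *)

Section Pochhammer.
Context {R : realType}.
Implicit Types (a b c x : R) (k l m n : nat).

Lemma poch0 a : poch a 0 = 1.
Proof. by rewrite /poch big_ord0. Qed.

Lemma pochS a m : poch a m.+1 = poch a m * (a + m%:R).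
Proof. by rewrite /poch big_ord_recr. Qed.

Lemma poch_add a m k : poch a (m + k) = poch a m * poch (a + m%:R) k.
Proof.
elim: k => [|k IH]; first by rewrite addn0 poch0 mulr1.
by rewrite addnS !pochS IH -mulrA -addrA natrD.
Qed.

Lemma poch_gt0 a m : 0 < a -> 0 < poch a m.
Proof. by move=> a0; apply: prodr_gt0 => i _; rewrite ltr_wpDr. Qed.

Lemma poch1 m : poch (1 : R) m = m`!%:R.
Proof.
elim: m => [|m IH]; first by rewrite poch0.
by rewrite pochS IH factS mulnC natrM -natr1 addrC.
Qed.

Lemma fact_neq0 m : (m`!)%:R != 0 :> R.
Proof. by rewrite pnatr_eq0 -lt0n fact_gt0. Qed.

Lemma poch_nat m k : m`!%:R * poch (m.+1%:R : R) k = (m + k)`!%:R.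
Proof. by rewrite -!poch1 poch_add -natr1 addrC. Qed.

Lemma poch_oppn m k : (k <= m)%N ->
  poch (- m%:R : R) k * (m - k)`!%:R = (-1) ^+ k * m`!%:R.
Proof.
elim: k => [|k IH] km; first by rewrite poch0 subn0 expr0.
rewrite pochS exprS -mulrA -mulrA -IH 1?ltnW//.
rewrite (_ : (m - k)%N = (m - k.+1).+1); last lia.
rewrite factS natrM.
have -> : ((m - k.+1).+1%:R : R) = m%:R - k%:R by rewrite -natrB 1?ltnW//; congr (_%:R); lia.
ring.
Qed.

Lemma poch_oppn_small m k : (m < k)%N -> poch (- m%:R : R) k = 0.
Proof.
by move=> mk; rewrite /poch (bigD1 (Ordinal mk)) //= addNr mul0r.
Qed.

(* The coefficient of [x^m] in [(1 - x)^(-a)]. *)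
Definition nbin a m : R := poch a m / m`!%:R.

Lemma nbin_poch a m : poch a m = m`!%:R * nbin a m.
Proof. by rewrite /nbin mulrCA divff ?mulr1 // fact_neq0. Qed.

Lemma nbinS a m : m.+1%:R * nbin a m.+1 = (a + m%:R) * nbin a m.
Proof.
rewrite /nbin pochS factS natrM.
have := fact_neq0 m; have : (m.+1%:R : R) != 0 by rewrite pnatr_eq0.
by move=> h1 h2; field; rewrite h2 addrC natr1.
Qed.

Lemma nbin_gt0 a m : 0 < a -> 0 < nbin a m.
Proof. by move=> a0; rewrite divr_gt0 ?poch_gt0 // ltr0n fact_gt0. Qed.

(** Induction on [m]: writing [m + 1 = i + (m + 1 - i)] and applying [nbinS] to each half amounts to
    differentiating the product of two generating functions. *)
Lemma nbin_vandermonde a b m :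
  \sum_(i < m.+1) nbin a i * nbin b (m - i) = nbin (a + b) m.
Proof.
elim: m => [|m IH].
  by rewrite big_ord1 /nbin !poch0 fact0 divr1 mulr1.
have m0 : (m.+1%:R : R) != 0 by rewrite pnatr_eq0.
apply: (mulfI m0); rewrite nbinS -IH !mulr_sumr.
transitivity (\sum_(i < m.+2) (i%:R * nbin a i) * nbin b (m.+1 - i)
   + \sum_(i < m.+2) nbin a i * ((m.+1 - i)%:R * nbin b (m.+1 - i))).
  rewrite -big_split /=; apply: eq_bigr => i _.
  have -> : (m.+1%:R : R) = i%:R + (m.+1 - i)%:R.
    by rewrite -natrD subnKC // -ltnS.
  ring.
rewrite big_ord_recl /= mul0r mul0r add0r.
rewrite [X in _ + X]big_ord_recr /= subnn mul0r mulr0 addr0 -big_split /=.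
apply: eq_bigr => i _; rewrite /bump /= add1n subSS nbinS.
have im : (i <= m)%N by rewrite -ltnS.
rewrite subSn // nbinS natrB //; ring.
Qed.

(** Pascal's rule: a difference of order [r + 1] is one of order [r] applied to a first
    difference. *)
Lemma alternating_binomial_sumS r (f : nat -> R) :
  \sum_(k < r.+2) (-1) ^+ k * 'C(r.+1, k)%:R * f k
  = \sum_(k < r.+1) (-1) ^+ k * 'C(r, k)%:R * (f k - f k.+1).
Proof.
rewrite big_ord_recl /= bin0.
under eq_bigr => i _ do rewrite /bump /= add1n binS natrD mulrDr mulrDl.
rewrite big_split /= addrA.
under [RHS]eq_bigr => i _ do rewrite mulrBr.
rewrite sumrB; congr (_ + _).
  rewrite big_ord_recr /= bin_small // mulr0 mul0r addr0.
  by rewrite [RHS]big_ord_recl /= bin0.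
by rewrite -sumrN; apply: eq_bigr => i _; rewrite exprS; ring.
Qed.

Lemma pochSl a m : poch a m.+1 = a * poch (a + 1) m.
Proof. by rewrite -add1n poch_add pochS poch0 mul1r addr0. Qed.

Lemma poch_shiftB c s :
  poch c s.+1 - poch (c + 1) s.+1 = - s.+1%:R * poch (c + 1) s.
Proof. by rewrite pochSl pochS -natr1; ring. Qed.

(* A finite difference of order [r] kills polynomials of degree [s < r]. *)
Lemma alternating_poch_sum r s c : (s < r)%N ->
  \sum_(k < r.+1) (-1) ^+ k * 'C(r, k)%:R * poch (c + k%:R) s = 0.
Proof.
elim: r s c => // r IH [|s] c sr.
  rewrite (alternating_binomial_sumS r (fun k => poch (c + k%:R) 0)).
  by rewrite big1 // => k _; rewrite !poch0 subrr mulr0.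
rewrite (alternating_binomial_sumS r (fun k => poch (c + k%:R) s.+1)).
under eq_bigr => k _.
  rewrite -natr1 addrA poch_shiftB mulrCA addrAC; over.
by rewrite -mulr_sumr IH // mulr0.
Qed.

(** Both [(c)_(s+k)] and [(c)_N] factor through [(c)_k]. On the right, [k] enters only through a
    polynomial of degree [s]. *)
Lemma poch_ratio c N s k : 0 < c -> (k <= N)%N ->
  poch (c + s%:R) k * poch (c + k%:R) (N - k)
  = poch c N / poch c s * poch (c + k%:R) s.
Proof.
move=> c0 kN.
have s0 : poch c s != 0 by rewrite gt_eqF ?poch_gt0.
have k0 : poch c k != 0 by rewrite gt_eqF ?poch_gt0.
have e1 : poch c N = poch c k * poch (c + k%:R) (N - k).
  by rewrite -poch_add subnKC.
have e2 : poch c s * poch (c + s%:R) k = poch c k * poch (c + k%:R) s.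
  by rewrite -!poch_add addnC.
apply: (mulfI s0); rewrite mulrA e2 e1.
by field; rewrite s0.
Qed.

End Pochhammer.

(** * Pochhammer products as polynomials, and bases graded by degree *)

Section Polynomials.
Context {R : realType}.
Implicit Types (a c x : R) (p q : {poly R}) (k d : nat).

(** The two parameters cover the three bases used below: [(1 - x)_k] for the Hahn series,
    [(theta + n - x)_l] for orthogonality and [(x)_k] for the operator. *)
Definition poch_poly a c k : {poly R} :=
  \prod_(i < k) (a *: 'X + (c + i%:R)%:P).

Lemma horner_poch_poly a c k x : (poch_poly a c k).[x] = poch (a * x + c) k.
Proof.
rewrite horner_prod; apply: eq_bigr => i _.
by rewrite hornerD hornerZ hornerX hornerC addrA.
Qed.

Lemma size_poch_poly a c k : a != 0 -> size (poch_poly a c k) = k.+1.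
Proof.
move=> a0; have sz i : size (a *: 'X + (c + i%:R)%:P) = 2.
  by rewrite size_polyDl size_scale ?size_polyX // size_polyC; case: eqP.
rewrite size_prod => [|i _]; last by rewrite -size_poly_eq0 sz.
by rewrite (eq_bigr (fun=> 2)) // sum_nat_const cardT size_enum_ord; lia.
Qed.

Lemma coef_poch_poly a c k : a != 0 -> (poch_poly a c k)`_k = a ^+ k.
Proof.
move=> a0; have -> : (poch_poly a c k)`_k = lead_coef (poch_poly a c k).
  by rewrite /lead_coef size_poch_poly.
rewrite lead_coef_prod (eq_bigr (fun=> a)) ?prodr_const ?cardT ?size_enum_ord //.
move=> i _; rewrite lead_coefDl ?lead_coefZ ?lead_coefX ?mulr1 //.
by rewrite size_scale ?size_polyX // size_polyC; case: eqP.
Qed.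

Lemma size_poly_le_coef0 d p : (size p <= d.+1)%N -> p`_d = 0 -> (size p <= d)%N.
Proof.
move=> sp pd; apply/leq_sizeP => j; rewrite leq_eqVlt => /orP[/eqP <- //|dj].
by rewrite nth_default // (leq_trans sp).
Qed.

(** Since [b d] has degree exactly [d], subtracting a multiple of it removes the coefficient of
    degree [d]. *)
Lemma poly_basis_ind (b : nat -> {poly R}) (P : nat -> {poly R} -> Prop) :
  (forall k, size (b k) = k.+1) -> P 0%N 0 ->
  (forall d c p, (size p <= d)%N -> P d p -> P d.+1 (c *: b d + p)) ->
  forall d p, (size p <= d)%N -> P d p.
Proof.
move=> sb P0 PS; elim=> [|d IH] p sp.
  by move: sp; rewrite leqn0 size_poly_eq0 => /eqP ->.
have bd : (b d)`_d != 0.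
  have <- : lead_coef (b d) = (b d)`_d by rewrite /lead_coef sb.
  by rewrite lead_coef_eq0 -size_poly_eq0 sb.
pose c := p`_d / (b d)`_d.
have sp' : (size (p - c *: b d)%R <= d)%N.
  apply: size_poly_le_coef0; last by rewrite coefB coefZ divfK // subrr.
  apply: leq_trans (size_polyD _ _) _; rewrite size_polyN geq_max sp /=.
  by rewrite (leq_trans (size_scale_leq _ _)) // sb.
by rewrite -(subrK (c *: b d) p) addrC; apply: PS (IH _ sp').
Qed.

End Polynomials.

(** * The weighted inner product on the nodes *)

Section Hahn.
Context {R : realType}.
Variables (theta : R) (N : nat).
Hypothesis theta_gt0 : 0 < theta.
Implicit Types (p q : {poly R}) (i j k l r d : nat).

(* The Hahn weight at the node [i + 1]; here and below [n = N + 1]. *)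
Definition weight i : R := i.+1%:R * nbin theta (N - i).

Lemma weight_gt0 i : 0 < weight i.
Proof. by rewrite mulr_gt0 ?nbin_gt0 // ltr0n. Qed.

Definition inner p q : R :=
  \sum_(i < N.+1) weight i * p.[i.+1%:R] * q.[i.+1%:R].

Lemma innerC p q : inner p q = inner q p.
Proof. by apply: eq_bigr => i _; rewrite -!mulrA [_ * q.[_]]mulrC. Qed.

Lemma innerDr p q1 q2 : inner p (q1 + q2) = inner p q1 + inner p q2.
Proof. by rewrite -big_split; apply: eq_bigr => i _; rewrite hornerD mulrDr. Qed.

Lemma innerZr p c q : inner p (c *: q) = c * inner p q.
Proof. by rewrite mulr_sumr; apply: eq_bigr => i _; rewrite hornerZ mulrCA. Qed.

Lemma inner0r p : inner p 0 = 0.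
Proof. by rewrite /inner big1 // => i _; rewrite horner0 mulr0. Qed.

Lemma inner_sumr p (I : Type) (s : seq I) (f : I -> {poly R}) :
  inner p (\sum_(i <- s) f i) = \sum_(i <- s) inner p (f i).
Proof. exact: (big_morph _ (innerDr p) (inner0r p)). Qed.

Lemma inner_eq0 p : inner p p = 0 -> forall i, (i < N.+1)%N -> p.[i.+1%:R] = 0.
Proof.
move=> /eqP; rewrite psumr_eq0 => [/allP h i iN|i _]; last first.
  by rewrite -mulrA -expr2 mulr_ge0 ?sqr_ge0 // ltW // weight_gt0.
have := h (Ordinal iN) (mem_index_enum _); rewrite /= -mulrA -expr2.
by rewrite mulf_eq0 sqrf_eq0 gt_eqF ?weight_gt0 //= => /eqP.
Qed.

Lemma poly_eq0_on_nodes p : (size p <= N.+1)%N ->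
  (forall i, (i < N.+1)%N -> p.[i.+1%:R] = 0) -> p = 0.
Proof.
move=> sp hp; apply/eqP; apply: contraTT sp => p0; rewrite -ltnNge.
pose s := [seq (i.+1%:R : R) | i <- iota 0 N.+1].
rewrite -[N.+1](size_iota 0) -(size_map (fun i => i.+1%:R : R)).
apply: max_poly_roots => //.
  apply/allP => x /mapP[i]; rewrite mem_iota => /andP[_ iN] ->.
  by apply/rootP/hp.
by rewrite map_inj_uniq ?iota_uniq // => i j /eqP; rewrite eqr_nat => /eqP[].
Qed.

(** The weights are positive, and a nonzero polynomial of degree at most [N] cannot vanish at all
    [N + 1] nodes. *)
Lemma inner_gt0 p : p != 0 -> (size p <= N.+1)%N -> 0 < inner p p.
Proof.
move=> p0 sp; rewrite lt_def; apply/andP; split; last first.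
  by apply: sumr_ge0 => i _; rewrite -mulrA -expr2 mulr_ge0 ?sqr_ge0 // ltW // weight_gt0.
apply: contra p0 => /eqP h; apply/eqP.
exact: poly_eq0_on_nodes sp (inner_eq0 _ h).
Qed.

(** * Hahn polynomials: degree and orthogonality *)

Definition hahn_coef r k : R :=
  poch (- r%:R) k * poch (r%:R + theta + 1) k
  / (poch 2 k * poch (1 - N.+1%:R) k * k`!%:R).

Definition hahn r : {poly R} :=
  \sum_(k < r.+1) hahn_coef r k *: poch_poly (-1) 1 k.

Lemma horner_hahn r x : (hahn r).[x] = q_poly theta N.+1 r x.
Proof.
rewrite horner_sum; apply: eq_bigr => k _.
by rewrite hornerZ horner_poch_poly mulN1r addrC /hahn_coef mulrAC [_ * poch _ k * poch _ k]mulrAC.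
Qed.

Let subN : (1 - N.+1%:R : R) = - N%:R.
Proof. by rewrite -natr1; ring. Qed.

Let poch_oppn_neq0 m k : (k <= m)%N -> poch (- m%:R : R) k != 0.
Proof.
move=> km; apply/eqP => e; have /eqP := poch_oppn (R := R) m k km.
by rewrite e mul0r eq_sym mulf_eq0 signr_eq0 (negbTE (fact_neq0 _)).
Qed.

Let poch2 k : poch (2 : R) k = k.+1`!%:R.
Proof. by rewrite -[LHS]mul1r -(poch_nat 1 k). Qed.

(** Only the term [k = r] reaches degree [r]. Its coefficient is nonzero because neither [(-r)_r]
    nor [(1 - n)_r] has a zero factor when [r <= N]. *)
Lemma size_hahn r : (r <= N)%N -> size (hahn r) = r.+1.
Proof.
move=> rN; apply/eqP; rewrite eqn_leq; apply/andP; split.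
  apply: leq_trans (size_sum _ _ _) _; apply/bigmax_leqP => k _.
  rewrite (leq_trans (size_scale_leq _ _)) // size_poch_poly ?oppr_eq0 ?oner_eq0 //.
rewrite leqNgt; apply/negP; rewrite ltnS => h; have : (hahn r)`_r = 0 by rewrite nth_default.
rewrite coef_sum big_ord_recr /= big1 => [|k _]; last first.
  rewrite coefZ nth_default ?mulr0 // size_poch_poly ?oppr_eq0 ?oner_eq0 //.
rewrite add0r coefZ coef_poch_poly ?oppr_eq0 ?oner_eq0 // => /eqP.
rewrite mulf_eq0 signr_eq0 orbF /hahn_coef mulf_eq0 mulf_eq0 invr_eq0.
rewrite subN !mulf_eq0 poch2 !(negbTE (fact_neq0 _)) !(negbTE (poch_oppn_neq0 _ _ _)) //.
by rewrite !orbF gt_eqF // poch_gt0 // !ltr_wpDl ?ltr01 // addr_ge0 // ltW.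
Qed.

Lemma hahn_neq0 r : (r <= N)%N -> hahn r != 0.
Proof. by move=> rN; rewrite -size_poly_eq0 size_hahn. Qed.

(** The factor [(theta + n - x)_l] raises the parameter of the weight from [theta] to [theta + l],
    while [x (1 - x)_k] becomes a multiple of a [nbin] of parameter [k + 2]; Vandermonde's
    convolution then applies. *)
Lemma inner_poch_poly l k : (k <= N)%N ->
  inner (poch_poly (-1) (theta + N.+1%:R) l) (poch_poly (-1) 1 k)
  = (-1) ^+ k * k.+1`!%:R * poch theta l
    * nbin (theta + l%:R + k.+2%:R) (N - k).
Proof.
move=> kN; rewrite [theta + l%:R + _]addrC -nbin_vandermonde mulr_sumr /inner.
rewrite (_ : N.+1 = (k + (N - k).+1)%N); last lia.
(* At the nodes [x <= k] the factor [(1 - x)_k] vanishes. *)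
rewrite big_split_ord /= big1 ?add0r => [|i _]; last first.
  rewrite [X in _ * X]horner_poch_poly (_ : -1 * i.+1%:R + 1 = - i%:R); last first.
    by rewrite -natr1; ring.
  by rewrite poch_oppn_small ?mulr0.
apply: eq_bigr => i _; rewrite !horner_poch_poly /weight.
have iN : (i <= N - k)%N by rewrite -ltnS.
have -> : -1 * (k + i).+1%:R + (theta + (k + (N - k).+1)%:R)
  = theta + (N - k - i)%:R :> R.
  rewrite (_ : (k + (N - k).+1)%N = (N - k - i + (k + i).+1)%N); last lia.
  by rewrite natrD; ring.
have -> : -1 * (k + i).+1%:R + 1 = - (k + i)%:R :> R by rewrite -natr1; ring.
rewrite (_ : (N - (k + i))%N = (N - k - i)%N); last lia.
set m := (N - k - i)%N.
have e1 : nbin theta m * poch (theta + m%:R) l = poch theta l * nbin (theta + l%:R) m.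
  by rewrite /nbin mulrAC -poch_add mulrA -poch_add addnC.
have e2 : (k + i).+1%:R * poch (- (k + i)%:R) k = (-1) ^+ k * k.+1`!%:R * nbin k.+2%:R i :> R.
  apply: (mulIf (fact_neq0 i)); have := poch_oppn (R := R) (k + i) k (leq_addr _ _).
  rewrite addKn => h; rewrite -[LHS]mulrA h /nbin -!mulrA mulVf ?fact_neq0 // mulr1.
  by rewrite poch_nat addSn factS natrM; ring.
transitivity (((k + i).+1%:R * poch (- (k + i)%:R) k)
   * (nbin theta m * poch (theta + m%:R) l)); first by ring.
rewrite e1 e2; ring.
Qed.

Lemma inner_hahn_poch_poly r l : (l < r)%N -> (r <= N)%N ->
  inner (poch_poly (-1) (theta + N.+1%:R) l) (hahn r) = 0.
Proof.
(* Chosen so that [c + k] is the parameter produced by [inner_poch_poly] and [c + s] is the upper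
   parameter [r + theta + 1] of the series. *)
move=> lr rN; rewrite inner_sumr; pose c := theta + l%:R + 2; pose s := (r - l.+1)%N.
have c0 : 0 < c by rewrite ltr_wpDr // ltr_wpDr.
have rs : r%:R + theta + 1 = c + s%:R.
  by rewrite /c /s natrB // -natr1; ring.
transitivity (poch theta l / N`!%:R * (poch c N / poch c s)
  * \sum_(k < r.+1) (-1) ^+ k * 'C(r, k)%:R * poch (c + k%:R) s); last first.
  by rewrite alternating_poch_sum ?mulr0 // /s; lia.
rewrite mulr_sumr; apply: eq_bigr => k _.
have kr : (k <= r)%N by rewrite -ltnS.
have kN : (k <= N)%N by exact: leq_trans rN.
rewrite innerZr inner_poch_poly // /hahn_coef rs subN poch2 /nbin.
have -> : theta + l%:R + k.+2%:R = c + k%:R.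
  by rewrite /c -(addn2 k) natrD; ring.
(* The alternating binomial coefficients of the finite difference come from here. *)
have hr : poch (- r%:R) k = (-1) ^+ k * 'C(r, k)%:R * k`!%:R :> R.
  apply: (mulIf (fact_neq0 (r - k))); rewrite poch_oppn // -(bin_fact kr) !natrM; ring.
have hN : N`!%:R^-1 = (-1) ^+ k / (poch (- N%:R) k * (N - k)`!%:R) :> R.
  by rewrite poch_oppn // invfM invr_sign mulrA -expr2 sqrr_sign mul1r.
transitivity (poch theta l * ((-1) ^+ k * 'C(r, k)%:R) / N`!%:R
  * (poch (c + s%:R) k * poch (c + k%:R) (N - k))).
  rewrite hr hN; field.
  by rewrite !fact_neq0 poch_oppn_neq0.
rewrite poch_ratio //; ring.
Qed.

Lemma inner_hahn r p : (r <= N)%N -> (size p <= r)%N -> inner (hahn r) p = 0.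
Proof.
move=> rN; rewrite innerC.
suff H d q : (size q <= d)%N -> (d <= r)%N -> inner q (hahn r) = 0.
  by move=> sp; apply: (H r).
move: d q; apply: (poly_basis_ind (poch_poly (-1) (theta + N.+1%:R))
  (fun d q => (d <= r)%N -> inner q (hahn r) = 0)).
- by move=> k; rewrite size_poch_poly // oppr_eq0 oner_eq0.
- by move=> _; rewrite innerC inner0r.
move=> d c q _ IH dr; rewrite innerC innerDr innerZr innerC.
by rewrite inner_hahn_poch_poly // mulr0 add0r innerC IH // ltnW.
Qed.

(** * The operator conjugate to [M_mx] and its action on polynomials *)

Definition kernel i j : R :=
  Theta theta (N.+1%:Z - i.+1%:Z - j.+1%:Z)
  - nbin theta (N - i) * nbin theta (N - j) / nbin theta N.+1.

Lemma kernelC i j : kernel i j = kernel j i.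
Proof. by rewrite /kernel addrAC [nbin _ (N - i) * _]mulrC. Qed.

(* Both sides are the coefficient of [x^m] in [k! x (1 - x)^(-(theta + k + 1))]. *)
Lemma sum_poch_Theta k m : (m <= N.+1)%N ->
  \sum_(i < N.+1) poch i.+1%:R k * Theta theta (m%:Z - i.+1%:Z)
  = nbin theta m * (k`!%:R / poch theta k.+1 * (m%:R * poch (theta + m%:R) k)).
Proof.
case: m => [|m] mN.
  by rewrite mul0r !mulr0 big1 // => i _; rewrite sub0r mulr0.
rewrite ltnS in mN.
transitivity (\sum_(i < m.+1) k`!%:R * (nbin k.+1%:R i * nbin theta (m - i))).
  rewrite (_ : N.+1 = (m.+1 + (N - m))%N); last lia.
  rewrite big_split_ord /= [X in _ + X]big1 ?addr0 => [|i _]; last first.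
    (* Terms beyond [m] have a negative argument, where [Theta] is zero. *)
    by rewrite (_ : _ - _ = Negz i) ?mulr0 //; lia.
  apply: eq_bigr => i _; have im : (i <= m)%N by rewrite -ltnS.
  rewrite (_ : _ - _ = (m - i)%N :> int); last lia.
  rewrite mulrA; congr (_ * _); apply: (mulfI (fact_neq0 i)).
  by rewrite poch_nat mulrCA -nbin_poch poch_nat addnC.
rewrite -mulr_sumr nbin_vandermonde /nbin factS natrM.
have e : poch theta k.+1 * poch (k.+1%:R + theta) m
   = poch theta m.+1 * poch (theta + m.+1%:R) k.
  by rewrite [k.+1%:R + _]addrC -!poch_add addnC addnS addSn.
have t0 : poch theta k.+1 != 0 by rewrite gt_eqF // poch_gt0.
have -> : poch (k.+1%:R + theta) m
  = poch theta m.+1 * poch (theta + m.+1%:R) k / poch theta k.+1.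
  by rewrite -e mulrAC divff // mul1r.
have m0 : (m.+1%:R : R) != 0 by rewrite pnatr_eq0.
field; rewrite t0 fact_neq0 /=; move: m0; by rewrite -natr1 addrC.
Qed.

(** This is [mu theta d.+1], indexed by the degree of the eigenfunction. *)
Definition eigval d : R := (-1) ^+ d.+1 * d`!%:R / poch theta d.+1.

(* [q] is the image of [p] under the operator with matrix [kernel i j / weight j]
   on functions on the nodes [1, ..., N + 1], which is conjugate to [M_mx] through
   the diagonal matrix of the square roots of the weights. *)
Definition represents p q := forall j, (j < N.+1)%N ->
  \sum_(i < N.+1) p.[i.+1%:R] * kernel i j = weight j * q.[j.+1%:R].

Lemma represents_poch k : exists q, [/\ (size q <= k.+1)%N, q`_k = eigval k
  & represents (poch_poly 1 0 k) q].
Proof.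
have oneN : (-1 : R) != 0 by rewrite oppr_eq0 oner_eq0.
(* [f] is the function [F] of the overview, and [G] is [F(n - x) - F(n)] as a polynomial in [x]. *)
pose f (x : R) := k`!%:R / poch theta k.+1 * (x * poch (theta + x) k).
pose P := poch_poly (-1) (theta + N.+1%:R) k.
have sP : size P = k.+1 by rewrite size_poch_poly.
pose G := (k`!%:R / poch theta k.+1) *: ((N.+1%:R%:P - 'X) * P) - (f N.+1%:R)%:P.
have GE x : G.[x] = f (N.+1%:R - x) - f N.+1%:R.
  rewrite /G hornerD hornerN hornerC hornerZ hornerM hornerD hornerN hornerC hornerX.
  by rewrite horner_poch_poly /f mulN1r addrCA [- x + _]addrC.
have sG : (size G <= k.+2)%N.
  rewrite (leq_trans (size_polyD _ _)) // geq_max size_polyN.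
  rewrite [X in _ && X](leq_trans (size_polyC_leq1 _)) // andbT.
  rewrite (leq_trans (size_scale_leq _ _)) // (leq_trans (size_polyMleq _ _)) //.
  by rewrite sP addrC size_polyDl ?size_polyN ?size_polyX // ltnS size_polyC_leq1.
(* The root at [0] makes the division by [x] exact; the quotient is the image. *)
have : root G 0 by rewrite rootE GE subr0 subrr.
move=> /factor_theorem[q]; rewrite subr0 => Gq; exists q; split.
- case: (eqVneq q 0) => [-> | q0]; first by rewrite size_poly0.
  by move: sG; rewrite Gq size_mulX.
(* The top coefficient of [G] is that of [- 'X * P], up to the constant factor; this gives the sign
   [(-1) ^+ k.+1]. *)
- have -> : q`_k = G`_k.+1 by rewrite Gq coefMX.
  rewrite coefB coefC subr0 coefZ mulrBl coefB coefCM coefXM /=.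
  rewrite [P`_k.+1]nth_default ?sP // coef_poch_poly // /eigval exprS; ring.
move=> j jN; rewrite /kernel.
under eq_bigr => i _ do rewrite horner_poch_poly mul1r addr0 mulrBr.
rewrite sumrB.
under eq_bigr => i _ do rewrite addrAC.
rewrite (_ : N.+1%:Z - j.+1%:Z = (N - j)%:Z); last lia.
rewrite sum_poch_Theta; last lia.
(* The rank-one part of the kernel gives the same sum at [m = n], hence the subtracted constant
   [F(n)]. *)
have e : \sum_(i < N.+1) poch i.+1%:R k
      * (nbin theta (N - i) * nbin theta (N - j) / nbin theta N.+1)
  = nbin theta (N - j) / nbin theta N.+1
    * \sum_(i < N.+1) poch i.+1%:R k * Theta theta (N.+1%:Z - i.+1%:Z).
  rewrite mulr_sumr; apply: eq_bigr => i _.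
  rewrite (_ : N.+1%:Z - i.+1%:Z = (N - i)%:Z) /=; last by have := ltn_ord i; lia.
  rewrite -/(nbin theta (N - i)); ring.
have n0 : nbin theta N.+1 != 0 by rewrite gt_eqF // nbin_gt0.
rewrite e sum_poch_Theta // -/(f _) -/(f _) mulrA divfK // -mulrBr /weight.
have := GE j.+1%:R; rewrite Gq hornerM hornerX.
have -> : N.+1%:R - j.+1%:R = (N - j)%:R :> R by rewrite -natrB // subSS.
by move=> <-; ring.
Qed.

(** By linearity from [represents_poch]. The induction runs on a size bound [d], so the top
    coefficient is stated through a predecessor of [d]. *)
Lemma represents_poly d p : (size p <= d)%N ->
  exists q, [/\ (size q <= d)%N, represents p q
    & forall d', d = d'.+1 -> q`_d' = eigval d' * p`_d'].
Proof.
have one0 : (1 : R) != 0 by rewrite oner_eq0.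
move: d p; apply: (poly_basis_ind (poch_poly 1 0)).
- by move=> k; apply: size_poch_poly.
- exists 0; split => //; first by rewrite size_poly0.
  by move=> j _; rewrite horner0 mulr0 big1 // => i _; rewrite horner0 mul0r.
move=> d c p sp [q [sq pq _]].
have [h [sh hd hr]] := represents_poch d.
exists (c *: h + q); split.
- rewrite (leq_trans (size_polyD _ _)) // geq_max (leqW sq) andbT.
  by rewrite (leq_trans (size_scale_leq _ _)).
- move=> j jN; rewrite hornerD hornerZ mulrDr -pq // mulrCA -hr //.
  rewrite mulr_sumr -big_split /=; apply: eq_bigr => i _.
  by rewrite hornerD hornerZ; ring.
(* Both [p] and [q] have size at most [d], so only the new basis element contributes in degree
   [d]. *)
move=> _ [<-]; rewrite !coefD !coefZ hd coef_poch_poly // expr1n.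
by rewrite !nth_default //; ring.
Qed.

(** Self-adjointness: [kernel] is symmetric, so both sides are the same double sum. *)
Lemma represents_inner p q p' q' : represents p q -> represents p' q' ->
  inner q p' = inner p q'.
Proof.
move=> pq pq'; rewrite [RHS]innerC /inner.
transitivity (\sum_(j < N.+1) \sum_(i < N.+1) p.[i.+1%:R] * kernel i j * p'.[j.+1%:R]).
  by apply: eq_bigr => j _; rewrite -pq // mulr_suml.
rewrite exchange_big /=; apply: eq_bigr => i _.
rewrite -pq' // mulr_suml; apply: eq_bigr => j _; rewrite kernelC; ring.
Qed.

(* The image of [hahn r] minus [eigval r *: hahn r] has degree less than [r] and,
   the operator being self-adjoint and preserving degrees, it is orthogonal to
   all such polynomials, itself included. *)
Lemma represents_hahn r : (r <= N)%N -> represents (hahn r) (eigval r *: hahn r).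
Proof.
move=> rN; have sz := size_hahn _ rN.
have [q [sq hq qd]] := represents_poly r.+1 (hahn r) (eq_leq sz).
pose D := q - eigval r *: hahn r.
have sD : (size D <= r)%N.
  apply: size_poly_le_coef0; last by rewrite coefB coefZ qd // subrr.
  rewrite (leq_trans (size_polyD _ _)) // geq_max sq size_polyN /=.
  by rewrite (leq_trans (size_scale_leq _ _)) // sz.
have DD : inner D D = 0.
  have [q' [sq' hq' _]] := represents_poly r D sD.
  (* Self-adjointness moves the operator onto [D], whose image [q'] still has size at most [r] and
     is thus orthogonal to [hahn r]. *)
  rewrite {2}/D innerDr innerC (represents_inner _ _ _ _ hq hq') inner_hahn //.
  by rewrite -scaleNr innerZr innerC inner_hahn // mulr0 addr0.
move=> j jN; rewrite hq //; congr (_ * _).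
by have := inner_eq0 D DD j jN; rewrite /D hornerD hornerN => /eqP; rewrite subr_eq0 => /eqP.
Qed.

End Hahn.

(** * From polynomials back to the vectors [e_vec] and the matrix [M_mx] *)

Section Eigenvectors.
Context {R : realType}.
Variables (theta : R) (N : nat).
Hypothesis theta_gt0 : 0 < theta.
Implicit Types (i j r s : nat).

Let w i : R := weight theta N i.
Let w_gt0 i : 0 < w i. Proof. exact: weight_gt0. Qed.
Let sw_neq0 i : Num.sqrt (w i) != 0.
Proof. by rewrite gt_eqF // sqrtr_gt0. Qed.

Lemma Theta_subn i : (i < N.+1)%N ->
  Theta theta (N.+1%:Z - i.+1%:Z) = nbin theta (N - i).
Proof. by move=> iN; rewrite (_ : _ - _ = (N - i)%N :> int) //; lia. Qed.

Lemma M_entry_kernel i j : (i < N.+1)%N -> (j < N.+1)%N ->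
  M_entry theta N.+1 i.+1 j.+1
  = kernel theta N i j / (Num.sqrt (w i) * Num.sqrt (w j)).
Proof.
move=> iN jN; rewrite /M_entry !Theta_subn // -[Theta theta N.+1]/(nbin theta N.+1).
have n0 : 0 < nbin theta N.+1 by rewrite nbin_gt0.
have sqrt_ratio k : Num.sqrt (nbin theta (N - k) / (k.+1%:R * nbin theta N.+1))
    = nbin theta (N - k) / (Num.sqrt (w k) * Num.sqrt (nbin theta N.+1)).
  have b0 : 0 < nbin theta (N - k) by rewrite nbin_gt0.
  have rhs0 : 0 <= nbin theta (N - k) / (Num.sqrt (w k) * Num.sqrt (nbin theta N.+1)).
    by rewrite divr_ge0 ?(ltW b0) // mulr_ge0 ?sqrtr_ge0.
  (* The right side is nonnegative, so it is the root of its square and the radicands can be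
     compared. *)
  rewrite -[RHS](ger0_norm rhs0) -sqrtr_sqr.
  rewrite expr_div_n (exprMn _ (Num.sqrt (w k))) !sqr_sqrtr ?(ltW n0) ?(ltW (w_gt0 k)) //.
  congr (Num.sqrt _); rewrite /w /weight.
  have : (k.+1%:R : R) != 0 by rewrite pnatr_eq0.
  by move=> k0; field; move: k0; rewrite (gt_eqF b0) (gt_eqF n0) -natr1 addrC => ->.
have sM : Num.sqrt (w i * w j) = Num.sqrt (w i) * Num.sqrt (w j).
  by rewrite sqrtrM // ltW.
rewrite !sqrt_ratio -sM /kernel mulrBl.
congr (_ / Num.sqrt _ - _); first by rewrite /w /weight; ring.
have sn0 : Num.sqrt (nbin theta N.+1) != 0 by rewrite gt_eqF // sqrtr_gt0.
have := sqr_sqrtr (ltW n0); move: sn0; set t := Num.sqrt (nbin theta N.+1).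
move=> t0 <-; rewrite sM.
by field; rewrite !sw_neq0 t0.
Qed.

Lemma pi_norm_hahn r :
  pi_norm theta N.+1 r = Num.sqrt (inner theta N (hahn theta N r) (hahn theta N r)).
Proof.
congr (Num.sqrt _); rewrite big_add1 /= big_mkord; apply: eq_bigr => i _.
by rewrite Theta_subn // horner_hahn /weight; ring.
Qed.

Lemma pi_norm_gt0 r : (r <= N)%N -> 0 < pi_norm theta N.+1 r.
Proof.
by move=> rN; rewrite pi_norm_hahn sqrtr_gt0 inner_gt0 ?hahn_neq0 ?size_hahn.
Qed.

Lemma e_entry_hahn r j : (j < N.+1)%N -> e_entry theta N.+1 r.+1 j.+1
  = (pi_norm theta N.+1 r)^-1 * (hahn theta N r).[j.+1%:R] * Num.sqrt (w j).
Proof. by move=> jN; rewrite /e_entry Theta_subn // horner_hahn. Qed.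

(** The square roots in two matching entries multiply to the weight, which turns [dot] into a
    normalized [inner]. *)
Lemma dot_e_vec r s : (r <= N)%N -> (s <= N)%N ->
  dot (e_vec theta N.+1 r.+1) (e_vec theta N.+1 s.+1) = (r == s)%:R.
Proof.
move=> rN sN; transitivity ((pi_norm theta N.+1 r)^-1 * (pi_norm theta N.+1 s)^-1
  * inner theta N (hahn theta N r) (hahn theta N s)).
  rewrite mulr_sumr; apply: eq_bigr => j _; rewrite !mxE !e_entry_hahn //.
  by rewrite -/(w j) -[w j in RHS]sqr_sqrtr ?ltW //; ring.
case: (ltngtP r s) => [rs|sr|<-].
- by rewrite innerC inner_hahn ?mulr0 // size_hahn.
- by rewrite inner_hahn ?mulr0 // size_hahn.
have p0 : pi_norm theta N.+1 r != 0 by rewrite gt_eqF // pi_norm_gt0.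
rewrite -[inner _ _ _ _]sqr_sqrtr; last first.
  by rewrite ltW // inner_gt0 ?hahn_neq0 ?size_hahn.
by rewrite -pi_norm_hahn expr2 mulrACA mulVf // mulr1.
Qed.

(** The root of [w i] in the vector cancels the one in the matrix; the remaining
    [w j / Num.sqrt (w j)] restores the root in the result. *)
Lemma e_vec_eigen r : (r <= N)%N ->
  e_vec theta N.+1 r.+1 *m M_mx theta N.+1 = mu theta r.+1 *: e_vec theta N.+1 r.+1.
Proof.
move=> rN; apply/rowP => j; rewrite !mxE e_entry_hahn //.
have h := represents_hahn theta N theta_gt0 r rN j (ltn_ord j).
transitivity ((pi_norm theta N.+1 r)^-1 / Num.sqrt (w j)
  * \sum_(i < N.+1) (hahn theta N r).[i.+1%:R] * kernel theta N i j).
  rewrite mulr_sumr; apply: eq_bigr => i _; rewrite !mxE e_entry_hahn //.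
  rewrite M_entry_kernel //; set p := (pi_norm _ _ _)^-1.
  by field; rewrite !sw_neq0.
rewrite h hornerZ -[mu theta _]/(eigval theta r) -/(w j).
have := sqr_sqrtr (ltW (w_gt0 j)); move: (sw_neq0 j).
move: (Num.sqrt (w j)) (eigval theta r) => t m t0 <-; set p := (pi_norm _ _ _)^-1.
by field.
Qed.

(** Pairing a vanishing combination with the [r]-th vector isolates its [r]-th coefficient, so the
    family is free; its length is the dimension. *)
Lemma orthonormal_basisP n (X : n.-tuple 'rV[R]_n) :
  (forall r s : 'I_n, dot (tnth X r) (tnth X s) = (r == s)%:R) ->
  orthonormal_basis X.
Proof.
move=> XX; split=> //; rewrite basisEfree subvf dimvf /dim /= mul1n size_tuple leqnn !andbT.
apply/freeP => k k0 r; have : dot (\sum_(i < n) k i *: X`_i) (tnth X r) = 0.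
  by rewrite k0 /dot big1 // => j _; rewrite mxE mul0r.
suff -> : dot (\sum_(i < n) k i *: X`_i) (tnth X r) = \sum_(i < n) k i * (i == r)%:R.
  by rewrite (bigD1 r) //= eqxx mulr1 big1 ?addr0 // => i /negbTE ->; rewrite mulr0.
transitivity (\sum_(j < n) \sum_(i < n) k i * (tnth X i 0 j * tnth X r 0 j)).
  apply: eq_bigr => j _; rewrite summxE mulr_suml; apply: eq_bigr => i _.
  by rewrite mxE -tnth_nth mulrA.
by rewrite exchange_big; apply: eq_bigr => i _; rewrite -mulr_sumr -XX.
Qed.

End Eigenvectors.

Theorem theorem3 (R : realType) (theta : R) (n : nat)
    (htheta : 0 < theta) (hn : (2 <= n)%N) :
  orthonormal_basis [tuple e_vec theta n r.+1 | r < n]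
  /\ (forall r : nat, (1 <= r <= n)%N ->
        is_eigenvector (M_mx theta n) (mu theta r) (e_vec theta n r)).
Proof.
case: n hn => // N _; split.
  by apply: orthonormal_basisP => r s; rewrite !tnth_mktuple dot_e_vec // -ltnS.
case=> // r /= rN; split; last exact: e_vec_eigen.
(* A zero vector would contradict the unit norm. *)
apply/eqP => e0; have := dot_e_vec theta N htheta r r rN rN.
rewrite e0 eqxx /dot big1 => [/esym/eqP|j _]; last by rewrite mxE mul0r.
by rewrite oner_eq0.
Qed.
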